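(* Let $\gamma\in\mathbb{R}$ and let $E=(q_2,q_3)^T$ be a smooth $\mathbb{C}^2$-valued function of $(x,t)$ satisfying $$E_{xt}=\big[R+(\operatorname{Tr}R)I+\gamma I\big]E,\qquad R=\partial_x^{-1}(\rho_t),\qquad \rho=EE^\dagger,$$ where the integration constants entering $\partial_x^{-1}$ are such that the $2\times2$ matrix $R(x,t)$ is Hermitian. Then $$\partial_x(E^\dagger E_t)-\partial_t(E_x^\dagger E)=0,$$ and consequently $$\partial_x\operatorname{Im}(E^\dagger E_t)-\partial_t\operatorname{Im}(E_x^\dagger E)=0 .$$ Moreover, if $E$ is periodic in $x$ or rapidly decaying (together with its derivatives) as $x\to\pm\infty$, then $$\frac{d}{dt}\int\operatorname{Im}(E_x^\dagger E)\,dx=0,$$ the integral being over a period, respectively over $\mathbb{R}$.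
   Context: $\dagger$ denotes conjugate transpose, $I$ the $2\times2$ identity matrix, and $\operatorname{Tr}$ the trace. $\partial_x^{-1}$ denotes integration in $x$, with the convention $(\partial_x^{-1}f)(x,t)=\int_x^\infty f(x',t)\,dx'$ for rapidly decaying $f$, so that $\partial_x\partial_x^{-1}f=-f$ (in general up to a choice of integration constants, which may depend on $t$). In components, the equation is the coupled negative first order Klein–Gordon system $$q_{2,xt}=q_2[2\partial_x^{-1}(|q_2|^2)_t+\partial_x^{-1}(|q_3|^2)_t+\gamma]+q_3\partial_x^{-1}(q_2q_3^* )_t,$$ $$q_{3,xt}=q_2\partial_x^{-1}(q_2^*q_3)_t+q_3[\partial_x^{-1}(|q_2|^2)_t+2\partial_x^{-1}(|q_3|^2)_t+\gamma].$$
   Formalization: ''Rapidly decaying (together with its derivatives)'' is taken locally uniformly in t; decay for each fixed t is not enough, since a soliton located at x = v/t for t > 0, with E = 0 for t ≤ 0, violates conservation. *)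

(* Defs.v *)
From Stdlib Require Import Reals List.
From Coquelicot Require Import Coquelicot.
Open Scope R_scope.

(* Derivative of a complex-valued function of a real variable.  Coquelicot only
   provides the total operator [Derive] for real-valued functions, and
   [C_derive] is the holomorphic derivative; [is_derive_CDerive] relates this
   definition to the library's [is_derive] over the real scalars. *)
Definition CDerive (f : R -> C) (s : R) : C :=
  (Derive (fun u => Re (f u)) s, Derive (fun u => Im (f u)) s).

Lemma is_derive_CDerive (f : R -> C) (s : R) (l : C) :
  is_derive (K := R_AbsRing) (V := C_R_NormedModule) f s l ->
  CDerive f s = l.
Proof.
intros H.
assert (H1 : is_derive (fun u => Re (f u)) s (Re l)).
{ apply (filterdiff_ext_lin _ (fun y : R => fst (scal (V := C_R_NormedModule) y l))).
  - apply (filterdiff_comp' (U := R_NormedModule) (V := C_R_NormedModule)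
             (W := R_NormedModule) f (fun z : C_R_NormedModule => fst z) s
             (fun y : R => scal (V := C_R_NormedModule) y l) (fun z => fst z) H).
    apply filterdiff_linear, (is_linear_fst (U := R_NormedModule) (V := R_NormedModule)).
  - reflexivity. }
assert (H2 : is_derive (fun u => Im (f u)) s (Im l)).
{ apply (filterdiff_ext_lin _ (fun y : R => snd (scal (V := C_R_NormedModule) y l))).
  - apply (filterdiff_comp' (U := R_NormedModule) (V := C_R_NormedModule)
             (W := R_NormedModule) f (fun z : C_R_NormedModule => snd z) s
             (fun y : R => scal (V := C_R_NormedModule) y l) (fun z => snd z) H).
    apply filterdiff_linear, (is_linear_snd (U := R_NormedModule) (V := R_NormedModule)).
  - reflexivity. }
destruct l as [l1 l2]; unfold CDerive; f_equal.
- exact (is_derive_unique _ _ _ H1).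
- exact (is_derive_unique _ _ _ H2).
Qed.

(* Functions of (x,t) are curried, with x first. *)
Definition dx (f : R -> R -> C) (x t : R) : C := CDerive (fun y => f y t) x.
Definition dt (f : R -> R -> C) (x t : R) : C := CDerive (fun s => f x s) t.

Inductive coord := coord_x | coord_t.

Definition pd (c : coord) (f : R -> R -> C) : R -> R -> C :=
  match c with coord_x => dx f | coord_t => dt f end.

(* Iterated partial derivative; the head of the list is applied last. *)
Definition pds (w : list coord) (f : R -> R -> C) : R -> R -> C :=
  fold_right pd f w.

(* C^infinity on the plane: all iterated partial derivatives, in any order,
   exist and are jointly continuous. *)
Definition smooth (f : R -> R -> C) : Prop :=
  forall (w : list coord) (x t : R),
    ex_derive (K := R_AbsRing) (V := C_R_NormedModule)
      (fun y => pds w f y t) x /\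
    ex_derive (K := R_AbsRing) (V := C_R_NormedModule)
      (fun s => pds w f x s) t /\
    continuous (U := C_UniformSpace)
      (fun p : R * R => pds w f (fst p) (snd p)) (x, t).

(* f and all its partial derivatives decay faster than any power of x as
   x -> +oo and x -> -oo, locally uniformly in t.  Decay for each t separately
   would allow a bump to enter from infinity at some time, which breaks
   conservation laws. *)
Definition rapidly_decaying (f : R -> R -> C) : Prop :=
  forall (w : list coord) (n : nat) (a b : R),
    exists M : R, forall x t : R,
      a <= t <= b -> Rabs x ^ n * Cmod (pds w f x t) <= M.

Definition entry {m n : nat} (A : matrix (T := C) m n) (i j : nat) : C :=
  coeff_mat (RtoC 0) A i j.

Definition Mdx {m n : nat} (A : R -> R -> matrix (T := C) m n) (x t : R) :
  matrix (T := C) m n :=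
  mk_matrix m n (fun i j => dx (fun y s => entry (A y s) i j) x t).

Definition Mdt {m n : nat} (A : R -> R -> matrix (T := C) m n) (x t : R) :
  matrix (T := C) m n :=
  mk_matrix m n (fun i j => dt (fun y s => entry (A y s) i j) x t).

Definition adj {m n : nat} (A : matrix (T := C) m n) : matrix (T := C) n m :=
  mk_matrix n m (fun i j => Cconj (entry A j i)).

Definition Hermitian {n : nat} (A : matrix (T := C) n n) : Prop := adj A = A.

Definition Tr (A : matrix (T := C) 2 2) : C := (entry A 0 0 + entry A 1 1)%C.

(* Coquelicot's module structure on matrices has matrices, not elements of the
   base ring, as scalars. *)
Definition Mscale {m n : nat} (c : C) (A : matrix (T := C) m n) :
  matrix (T := C) m n :=
  mk_matrix m n (fun i j => (c * entry A i j)%C).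

(* The scalar u^dagger v, i.e. the only entry of this 1 x 1 matrix. *)
Definition adj_mul (u v : matrix (T := C) 2 1) : C :=
  entry (Mmult (T := C_Ring) (adj u) v) 0 0.

(* G = dx^{-1} F up to the choice of t-dependent integration constants.  The
   minus sign comes from the convention (dx^{-1} f)(x,t) = int_x^oo f(x',t) dx',
   for which dx dx^{-1} f = - f. *)
Definition is_dx_inv {m n : nat} (G F : R -> R -> matrix (T := C) m n) : Prop :=
  forall (i j : nat) (x t : R), (i < m)%nat -> (j < n)%nat ->
    is_derive (K := R_AbsRing) (V := C_R_NormedModule)
      (fun y => entry (G y t) i j) x (- entry (F x t) i j)%C.

Definition rho (E : R -> R -> matrix (T := C) 2 1) (x t : R) :
  matrix (T := C) 2 2 :=
  Mmult (T := C_Ring) (E x t) (adj (E x t)).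

Definition KG_matrix (gamma : R) (Q : matrix (T := C) 2 2) :
  matrix (T := C) 2 2 :=
  Mplus (G := C_AbelianGroup) (Mplus (G := C_AbelianGroup) Q
    (Mscale (Tr Q) (Mone (T := C_Ring))))
    (Mscale (RtoC gamma) (Mone (T := C_Ring))).

(* Main.v *)
(* Since E_xt = K E with K Hermitian, E^dagger E_xt = E_xt^dagger E; with the
   symmetry of mixed partials, d_x (E^dagger E_t) and d_t (E_x^dagger E) are then both
   equal to E_x^dagger E_t + E^dagger E_xt. Writing f = Im (E_x^dagger E) and
   g = Im (E^dagger E_t), the integral of f over [a, b] has time derivative
   g b - g a, which vanishes over a period. On the whole line it is O(1/a^2 + 1/b^2)
   locally uniformly in time, so the improper integral of f takes equal values at any
   two times; this avoids differentiating under an improper integral. *)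

Require Import Defs.
From Stdlib Require Import Reals List Lra Lia Psatz.
From Coquelicot Require Import Coquelicot.
Open Scope R_scope.

(** * Complex-valued functions: real and imaginary parts, smoothness, mixed partials *)

Lemma is_derive_Re_Im (f : R -> C) (s : R) (l : C) :
  is_derive (K := R_AbsRing) (V := C_R_NormedModule) f s l <->
  is_derive (fun u => Re (f u)) s (Re l) /\
  is_derive (fun u => Im (f u)) s (Im l).
Proof.
split.
- intros H; split.
  + apply (filterdiff_ext_lin _ (fun y : R => fst (scal (V := C_R_NormedModule) y l))).
    * apply (filterdiff_comp' (U := R_NormedModule) (V := C_R_NormedModule)
             (W := R_NormedModule) f (fun z : C_R_NormedModule => fst z) s
             (fun y : R => scal (V := C_R_NormedModule) y l) (fun z => fst z) H).
      apply filterdiff_linear, (is_linear_fst (U := R_NormedModule) (V := R_NormedModule)).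
    * reflexivity.
  + apply (filterdiff_ext_lin _ (fun y : R => snd (scal (V := C_R_NormedModule) y l))).
    * apply (filterdiff_comp' (U := R_NormedModule) (V := C_R_NormedModule)
             (W := R_NormedModule) f (fun z : C_R_NormedModule => snd z) s
             (fun y : R => scal (V := C_R_NormedModule) y l) (fun z => snd z) H).
      apply filterdiff_linear, (is_linear_snd (U := R_NormedModule) (V := R_NormedModule)).
    * reflexivity.
(* Conversely, [f] is the pair of its real and imaginary parts, and pairing is a linear map on the
   real plane, hence its own differential. *)
- intros [H1 H2].
  apply (filterdiff_ext (U := R_NormedModule) (V := C_R_NormedModule)
           (fun u => (Re (f u), Im (f u)))).
  { intros y; destruct (f y); reflexivity. }
  apply (filterdiff_comp'_2 (T := R_NormedModule) (U := R_NormedModule)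
           (V := R_NormedModule) (W := C_R_NormedModule)
           (fun u => Re (f u)) (fun u => Im (f u)) (fun a b => (a, b)) s
           (fun y => scal y (Re l)) (fun y => scal y (Im l)) (fun a b => (a, b)) H1 H2).
  apply (filterdiff_ext_lin _ (fun y => y)).
  + apply (filterdiff_ext (fun y => y)); [now intros [] | apply filterdiff_id].
  + now intros [].
Qed.

Lemma ex_derive_CDerive (f : R -> C) (s : R) :
  ex_derive (K := R_AbsRing) (V := C_R_NormedModule) f s ->
  is_derive (K := R_AbsRing) (V := C_R_NormedModule) f s (CDerive f s).
Proof. intros [l H]; rewrite (is_derive_CDerive _ _ _ H); exact H. Qed.

Lemma continuous_Re_Im (f : R * R -> C) (p : R * R) :
  continuous (U := prod_UniformSpace R_UniformSpace R_UniformSpace) (T := C_UniformSpace) f p ->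
  continuous (fun q => Re (f q)) p /\ continuous (fun q => Im (f q)) p.
Proof.
intros H; split.
- apply (continuous_comp (V := C_UniformSpace) f Re p H).
  destruct (f p); apply (continuous_fst (U := R_UniformSpace) (V := R_UniformSpace)).
- apply (continuous_comp (V := C_UniformSpace) f Im p H).
  destruct (f p); apply (continuous_snd (U := R_UniformSpace) (V := R_UniformSpace)).
Qed.

(** The head of a word is applied last, so differentiating [pd c f] along [w] amounts to
    differentiating [f] along [w] with [c] appended at its end. *)
Lemma smooth_pd (c : coord) (f : R -> R -> C) : smooth f -> smooth (pd c f).
Proof.
intros H w; generalize (H (w ++ c :: nil)%list).
unfold pds; now rewrite fold_right_app.
Qed.

Lemma rapidly_decaying_pd (c : coord) (f : R -> R -> C) :
  rapidly_decaying f -> rapidly_decaying (pd c f).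
Proof.
intros H w; generalize (H (w ++ c :: nil)%list).
unfold pds; now rewrite fold_right_app.
Qed.

Lemma continuity_2d_pt_Re_Im_pds (f : R -> R -> C) (w : list coord) (x t : R) :
  smooth f ->
  continuity_2d_pt (fun y s => Re (pds w f y s)) x t /\
  continuity_2d_pt (fun y s => Im (pds w f y s)) x t.
Proof.
intros H; destruct (H w x t) as (_ & _ & Hc).
destruct (continuous_Re_Im _ _ Hc) as [H1 H2].
split; apply continuity_2d_pt_filterlim; assumption.
Qed.

Lemma smooth_dx_dt (f : R -> R -> C) (x t : R) :
  smooth f -> dx (dt f) x t = dt (dx f) x t.
Proof.
intros H.
(* Schwarz's theorem is applied to the real and imaginary parts separately. Its differentiability
   hypotheses are the instances of [D] for the empty word and for the two words of length one. *)
assert (D : forall w y s,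
  (ex_derive (fun z => Re (pds w f z s)) y /\ ex_derive (fun z => Im (pds w f z s)) y) /\
  (ex_derive (fun z => Re (pds w f y z)) s /\ ex_derive (fun z => Im (pds w f y z)) s)).
{ intros w y s; destruct (H w y s) as ([l1 H1] & [l2 H2] & _).
  destruct (proj1 (is_derive_Re_Im _ _ _) H1) as [A1 B1].
  destruct (proj1 (is_derive_Re_Im _ _ _) H2) as [A2 B2].
  exact (conj (conj (ex_intro _ _ A1) (ex_intro _ _ B1))
    (conj (ex_intro _ _ A2) (ex_intro _ _ B2))). }
apply injective_projections; simpl.
- apply (Schwarz (fun y s => Re (f y s))).
  + apply locally_2d_forall; intros y s.
    exact (conj (proj1 (proj1 (D nil y s))) (conj (proj1 (proj2 (D nil y s)))
      (conj (proj1 (proj1 (D (coord_t :: nil) y s)))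
            (proj1 (proj2 (D (coord_x :: nil) y s)))))).
  + exact (proj1 (continuity_2d_pt_Re_Im_pds f (coord_x :: coord_t :: nil) x t H)).
  + exact (proj1 (continuity_2d_pt_Re_Im_pds f (coord_t :: coord_x :: nil) x t H)).
- apply (Schwarz (fun y s => Im (f y s))).
  + apply locally_2d_forall; intros y s.
    exact (conj (proj2 (proj1 (D nil y s))) (conj (proj2 (proj2 (D nil y s)))
      (conj (proj2 (proj1 (D (coord_t :: nil) y s)))
            (proj2 (proj2 (D (coord_x :: nil) y s)))))).
  + exact (proj2 (continuity_2d_pt_Re_Im_pds f (coord_x :: coord_t :: nil) x t H)).
  + exact (proj2 (continuity_2d_pt_Re_Im_pds f (coord_t :: coord_x :: nil) x t H)).
Qed.

(** * Matrix algebra: the form u^dagger v and Hermitian matrices *)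

Lemma Mmult_entry_2 {m n : nat} (A : matrix (T := C) m 2) (B : matrix (T := C) 2 n)
  (i j : nat) :
  (i < m)%nat -> (j < n)%nat ->
  entry (Mmult (T := C_Ring) A B) i j =
  (entry A i 0 * entry B 0 j + entry A i 1 * entry B 1 j)%C.
Proof.
intros Hi Hj; unfold entry, Mmult.
rewrite coeff_mat_bij by assumption; simpl pred.
now rewrite sum_Sn, sum_O.
Qed.

Lemma adj_entry {m n : nat} (A : matrix (T := C) m n) (i j : nat) :
  (i < n)%nat -> (j < m)%nat -> entry (adj A) i j = Cconj (entry A j i).
Proof. intros Hi Hj; unfold adj, entry at 1; now rewrite coeff_mat_bij. Qed.

Lemma adj_mul_entries (u v : matrix (T := C) 2 1) :
  adj_mul u v =
  (Cconj (entry u 0 0) * entry v 0 0 + Cconj (entry u 1 0) * entry v 1 0)%C.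
Proof. unfold adj_mul; rewrite Mmult_entry_2, !adj_entry; auto. Qed.

Lemma Re_adj_mul (u v : matrix (T := C) 2 1) :
  Re (adj_mul u v) =
  (Re (entry u 0 0) * Re (entry v 0 0) + Im (entry u 0 0) * Im (entry v 0 0))
  + (Re (entry u 1 0) * Re (entry v 1 0) + Im (entry u 1 0) * Im (entry v 1 0)).
Proof.
rewrite adj_mul_entries.
destruct (entry u 0 0), (entry v 0 0), (entry u 1 0), (entry v 1 0).
simpl; ring.
Qed.

Lemma Im_adj_mul (u v : matrix (T := C) 2 1) :
  Im (adj_mul u v) =
  (Re (entry u 0 0) * Im (entry v 0 0) - Im (entry u 0 0) * Re (entry v 0 0))
  + (Re (entry u 1 0) * Im (entry v 1 0) - Im (entry u 1 0) * Re (entry v 1 0)).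
Proof.
rewrite adj_mul_entries.
destruct (entry u 0 0), (entry v 0 0), (entry u 1 0), (entry v 1 0).
simpl; ring.
Qed.

Lemma Hermitian_entry {n : nat} (A : matrix (T := C) n n) (i j : nat) :
  Hermitian A -> (i < n)%nat -> (j < n)%nat -> Cconj (entry A i j) = entry A j i.
Proof. intros H Hi Hj; rewrite <- (adj_entry A j i), H; auto. Qed.

(** This is (K u)^dagger v = u^dagger K^dagger v with K^dagger = K. In entries, conjugation
    transposes the indices of [K], and both sides become the same sum of four products. *)
Lemma Hermitian_adj_mul (K : matrix (T := C) 2 2) (u v : matrix (T := C) 2 1) :
  Hermitian K ->
  adj_mul (Mmult (T := C_Ring) K u) v = adj_mul u (Mmult (T := C_Ring) K v).
Proof.
intros H; rewrite !adj_mul_entries, !Mmult_entry_2 by auto.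
rewrite !Cplus_conj, !Cmult_conj.
rewrite !(Hermitian_entry K) by auto.
ring.
Qed.

Lemma Mone_entry {n : nat} (i j : nat) :
  (i < n)%nat -> (j < n)%nat ->
  entry (Mone (T := C_Ring) : matrix (T := C) n n) i j =
  RtoC (if Nat.eqb i j then 1 else 0).
Proof.
intros Hi Hj; unfold entry, Mone; rewrite coeff_mat_bij by assumption.
clear Hi Hj; revert j; induction i as [| i IH]; intros [| j]; try reflexivity.
exact (IH j).
Qed.

Lemma KG_matrix_entry (gamma : R) (Q : matrix (T := C) 2 2) (i j : nat) :
  (i < 2)%nat -> (j < 2)%nat ->
  entry (KG_matrix gamma Q) i j =
  (entry Q i j + Tr Q * RtoC (if Nat.eqb i j then 1 else 0)
   + gamma * RtoC (if Nat.eqb i j then 1 else 0))%C.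
Proof.
intros Hi Hj; unfold KG_matrix, Mplus, Mscale, entry at 1.
rewrite !coeff_mat_bij by assumption.
rewrite !Mone_entry by assumption.
reflexivity.
Qed.

(** The diagonal entries of a Hermitian matrix are real, hence so is its trace. Thus [Q] is only
    shifted by real multiples of the identity. *)
Lemma Hermitian_KG_matrix (gamma : R) (Q : matrix (T := C) 2 2) :
  Hermitian Q -> Hermitian (KG_matrix gamma Q).
Proof.
intros H; unfold Hermitian.
rewrite <- (mk_matrix_bij (RtoC 0) (KG_matrix gamma Q)) at 2.
apply mk_matrix_ext; intros i j Hi Hj.
change (coeff_mat (RtoC 0) (KG_matrix gamma Q) i j) with (entry (KG_matrix gamma Q) i j).
rewrite !KG_matrix_entry by assumption.
rewrite !Cplus_conj, !Cmult_conj, (Hermitian_entry Q) by assumption.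
unfold Tr; rewrite Cplus_conj, !(Hermitian_entry Q) by auto.
assert (RC : forall r : R, Cconj (RtoC r) = RtoC r).
{ intros r; apply injective_projections; simpl; ring. }
now rewrite !RC, (Nat.eqb_sym j i).
Qed.

(** * Continuity and the product rule for u^dagger v *)

Lemma continuity_2d_pt_Im_adj_mul (U V : R -> R -> matrix (T := C) 2 1) (x t : R) :
  (forall i, (i < 2)%nat -> smooth (fun y s => entry (U y s) i 0)) ->
  (forall i, (i < 2)%nat -> smooth (fun y s => entry (V y s) i 0)) ->
  continuity_2d_pt (fun y s => Im (adj_mul (U y s) (V y s))) x t.
Proof.
intros HU HV.
apply (continuity_2d_pt_ext (fun y s =>
  (Re (entry (U y s) 0 0) * Im (entry (V y s) 0 0)
   - Im (entry (U y s) 0 0) * Re (entry (V y s) 0 0))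
  + (Re (entry (U y s) 1 0) * Im (entry (V y s) 1 0)
   - Im (entry (U y s) 1 0) * Re (entry (V y s) 1 0)))).
{ intros y s; symmetry; apply Im_adj_mul. }
apply continuity_2d_pt_plus; apply continuity_2d_pt_minus; apply continuity_2d_pt_mult;
  first [ apply (continuity_2d_pt_Re_Im_pds _ nil x t (HU 0%nat ltac:(auto)))
        | apply (continuity_2d_pt_Re_Im_pds _ nil x t (HV 0%nat ltac:(auto)))
        | apply (continuity_2d_pt_Re_Im_pds _ nil x t (HU 1%nat ltac:(auto)))
        | apply (continuity_2d_pt_Re_Im_pds _ nil x t (HV 1%nat ltac:(auto))) ].
Qed.

(** Conjugation is linear over the reals only, so both parts are expanded into products of real
    functions, to which the real product rule applies. *)
Lemma is_derive_adj_mul (U V : R -> matrix (T := C) 2 1)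
  (dU dV : matrix (T := C) 2 1) (s : R) :
  (forall i, (i < 2)%nat -> is_derive (K := R_AbsRing) (V := C_R_NormedModule)
     (fun y => entry (U y) i 0) s (entry dU i 0)) ->
  (forall i, (i < 2)%nat -> is_derive (K := R_AbsRing) (V := C_R_NormedModule)
     (fun y => entry (V y) i 0) s (entry dV i 0)) ->
  is_derive (K := R_AbsRing) (V := C_R_NormedModule)
    (fun y => adj_mul (U y) (V y)) s
    (adj_mul dU (V s) + adj_mul (U s) dV)%C.
Proof.
intros HU HV.
destruct (proj1 (is_derive_Re_Im _ _ _) (HU 0%nat ltac:(auto))) as [U0 U0'].
destruct (proj1 (is_derive_Re_Im _ _ _) (HU 1%nat ltac:(auto))) as [U1 U1'].
destruct (proj1 (is_derive_Re_Im _ _ _) (HV 0%nat ltac:(auto))) as [V0 V0'].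
destruct (proj1 (is_derive_Re_Im _ _ _) (HV 1%nat ltac:(auto))) as [V1 V1'].
assert (M : forall (f g : R -> R) (a b : R), is_derive f s a -> is_derive g s b ->
  is_derive (fun y => f y * g y) s (a * g s + f s * b)).
{ intros f g a b Hf Hg; apply (is_derive_mult f g s a b Hf Hg).
  intros n m; apply Rmult_comm. }
apply is_derive_Re_Im; split.
- apply (is_derive_ext (fun y =>
    (Re (entry (U y) 0 0) * Re (entry (V y) 0 0)
     + Im (entry (U y) 0 0) * Im (entry (V y) 0 0))
    + (Re (entry (U y) 1 0) * Re (entry (V y) 1 0)
     + Im (entry (U y) 1 0) * Im (entry (V y) 1 0)))).
  { intros y; symmetry; apply Re_adj_mul. }
  evar_last.
  + apply (is_derive_plus (K := R_AbsRing) (V := R_NormedModule));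
    apply (is_derive_plus (K := R_AbsRing) (V := R_NormedModule));
    apply M; eassumption.
  + change (Re (adj_mul dU (V s) + adj_mul (U s) dV)%C)
      with (Re (adj_mul dU (V s)) + Re (adj_mul (U s) dV)).
    rewrite !Re_adj_mul; unfold plus; simpl; ring.
- apply (is_derive_ext (fun y =>
    (Re (entry (U y) 0 0) * Im (entry (V y) 0 0)
     - Im (entry (U y) 0 0) * Re (entry (V y) 0 0))
    + (Re (entry (U y) 1 0) * Im (entry (V y) 1 0)
     - Im (entry (U y) 1 0) * Re (entry (V y) 1 0)))).
  { intros y; symmetry; apply Im_adj_mul. }
  evar_last.
  + apply (is_derive_plus (K := R_AbsRing) (V := R_NormedModule));
    apply (is_derive_minus (K := R_AbsRing) (V := R_NormedModule));
    apply M; eassumption.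
  + change (Im (adj_mul dU (V s) + adj_mul (U s) dV)%C)
      with (Im (adj_mul dU (V s)) + Im (adj_mul (U s) dV)).
    rewrite !Im_adj_mul; unfold minus, plus, opp; simpl; ring.
Qed.

(** * Improper integrals over the line under inverse-square decay *)

Lemma RInt_inv_sq_bound (f : R -> R) (M u v : R) :
  (forall x, continuous f x) ->
  (forall x, x ^ 2 * Rabs (f x) <= M) ->
  u <= v -> 0 < u \/ v < 0 ->
  Rabs (RInt f u v) <= M * (/ u - / v).
Proof.
intros Hc HM Huv H0.
(* The majorant M / x^2 has the primitive - M / x on an interval that avoids 0, and the sign
   condition on [u] and [v] ensures that this one does. *)
assert (Hnz : forall x, u <= x <= v -> x <> 0) by (intros x; lra).
apply (norm_RInt_le f (fun x => M * / x ^ 2) u v _ _ Huv).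
- intros x Hx.
  assert (0 < x ^ 2) by (apply pow2_gt_0, Hnz, Hx).
  apply (Rmult_le_reg_l (x ^ 2)); [assumption |].
  replace (x ^ 2 * (M * / x ^ 2)) with M by (field; now apply Hnz).
  apply HM.
- apply (RInt_correct f); apply (ex_RInt_continuous f); auto.
- evar_last.
  + apply (is_RInt_derive (fun x => - M * / x) (fun x => M * / x ^ 2)).
    * intros x Hx; rewrite Rmin_left, Rmax_right in Hx by assumption.
      auto_derive; [now apply Hnz | field; now apply Hnz].
    * intros x Hx; rewrite Rmin_left, Rmax_right in Hx by assumption.
      apply (ex_derive_continuous (V := R_NormedModule)); auto_derive.
      specialize (Hnz x Hx); intros E; apply Hnz.
      now apply Rmult_integral in E; destruct E; [| lra].
  + unfold minus, plus, opp; simpl; ring.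
Qed.

(** Improper integrals are limits of the relation [is_RInt]. For continuous [f] the total function
    [RInt] satisfies this relation on every interval, so an ordinary limit is enough. *)
Lemma is_RInt_gen_filterlim (f : R -> R) (l : R) :
  (forall x, continuous f x) ->
  filterlim (fun ab : R * R => RInt f (fst ab) (snd ab))
    (filter_prod (Rbar_locally m_infty) (Rbar_locally p_infty)) (locally l) ->
  is_RInt_gen f (Rbar_locally m_infty) (Rbar_locally p_infty) l.
Proof.
intros Hc H P HP.
refine (filter_imp (fun ab : R * R => P (RInt f (fst ab) (snd ab))) _ _ (H P HP)).
intros [a b] Hab; exists (RInt f a b); split; [| exact Hab].
apply (RInt_correct f); apply (ex_RInt_continuous f); auto.
Qed.

(** Cauchy's criterion in both endpoints at once: an integral over an interval beyond [N], on either
    side, is at most M / N. *)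
Lemma ex_RInt_gen_inv_sq (f : R -> R) (M : R) :
  (forall x, continuous f x) ->
  (forall x, x ^ 2 * Rabs (f x) <= M) ->
  ex_RInt_gen f (Rbar_locally m_infty) (Rbar_locally p_infty).
Proof.
intros Hc HM.
assert (M0 : 0 <= M).
{ specialize (HM 0); rewrite pow_i, Rmult_0_l in HM by auto; exact HM. }
assert (Hex : forall a b, ex_RInt f a b).
{ intros a b; apply (ex_RInt_continuous f); auto. }
destruct (proj1 (filterlim_locally_cauchy (U := R_CompleteSpace)
  (F := filter_prod (Rbar_locally m_infty) (Rbar_locally p_infty))
  (fun ab : R * R => RInt f (fst ab) (snd ab)))) as [l Hl].
2: { exists l; now apply is_RInt_gen_filterlim. }
intros eps.
(* Chosen so that M / N < eps / 2. Using M + 1 rather than M keeps [N] positive when M = 0. *)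
set (N := 2 * (M + 1) / eps).
assert (N0 : 0 < N).
{ apply Rdiv_lt_0_compat; [lra | apply cond_pos]. }
assert (HN : M * / N < eps / 2).
{ unfold N; assert (E := cond_pos eps).
  replace (M * / (2 * (M + 1) / eps)) with (eps / 2 * (M / (M + 1))) by (field; lra).
  rewrite <- (Rmult_1_r (eps / 2)) at 2.
  apply Rmult_lt_compat_l; [lra |].
  apply (Rdiv_lt_1 M (M + 1)); lra. }
assert (Hpos : forall u v, N < u -> N < v -> Rabs (RInt f u v) <= M * / N).
{ assert (W : forall u v, N < u -> u <= v -> Rabs (RInt f u v) <= M * / N).
  { intros u v Hu Huv.
    eapply Rle_trans; [apply (RInt_inv_sq_bound f M); auto; lra |].
    apply Rmult_le_compat_l; [exact M0 |].
    assert (/ u < / N) by (apply Rinv_lt_contravar; nra).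
    assert (0 < / v) by (apply Rinv_0_lt_compat; lra). lra. }
  intros u v Hu Hv; destruct (Rle_dec u v); [now apply W |].
  rewrite <- (opp_RInt_swap f v u) by auto.
  unfold opp; simpl; rewrite Rabs_Ropp; apply W; lra. }
assert (Hneg : forall u v, u < - N -> v < - N -> Rabs (RInt f u v) <= M * / N).
{ assert (W : forall u v, v < - N -> u <= v -> Rabs (RInt f u v) <= M * / N).
  { intros u v Hv Huv.
    eapply Rle_trans; [apply (RInt_inv_sq_bound f M); auto; lra |].
    apply Rmult_le_compat_l; [exact M0 |].
    assert (/ - v < / N) by (apply Rinv_lt_contravar; nra).
    assert (0 < / - u) by (apply Rinv_0_lt_compat; lra).
    rewrite Rinv_opp in *. lra. }
  intros u v Hu Hv; destruct (Rle_dec u v); [now apply W |].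
  rewrite <- (opp_RInt_swap f v u) by auto.
  unfold opp; simpl; rewrite Rabs_Ropp; apply W; lra. }
exists (fun ab : R * R => fst ab < - N /\ N < snd ab); split.
- apply (Filter_prod _ _ _ (fun a => a < - N) (fun b => N < b)); [now exists (- N) | now exists N |].
  now intros a b; split.
- intros [a b] [a' b'] [Ha Hb] [Ha' Hb']; simpl in *.
  change (Rabs (RInt f a' b' - RInt f a b) < eps).
  (* By additivity, the integrals over [a', b'] and [a, b] differ by one piece in each tail, and
     each piece is below eps / 2. *)
  rewrite <- (RInt_Chasles f a' a b') by auto.
  rewrite <- (RInt_Chasles f a b b') by auto.
  specialize (Hneg a' a Ha' Ha); specialize (Hpos b b' Hb Hb').
  unfold plus; simpl.
  replace (RInt f a' a + (RInt f a b + RInt f b b') - RInt f a b)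
    with (RInt f a' a + RInt f b b') by ring.
  eapply Rle_lt_trans; [apply Rabs_triang |]; lra.
Qed.

(** * Scalar conservation laws f_t = g_x = h, with density f *)

Definition conservation_law (f g h : R -> R -> R) : Prop :=
  (forall x t, continuous (fun y => f y t) x) /\
  (forall x t, is_derive (fun s => f x s) t (h x t)) /\
  (forall x t, is_derive (fun y => g y t) x (h x t)) /\
  (forall x t, continuity_2d_pt h x t).

(** The exponent 2 makes a continuous [f] integrable over the line. Uniformity on bounded time
    intervals is what allows an evaluation at the unknown time given by the mean value theorem. *)
Definition inv_sq_decay (f : R -> R -> R) : Prop :=
  forall a b, exists M, forall x t, a <= t <= b -> x ^ 2 * Rabs (f x t) <= M.

Lemma continuity_2d_pt_continuous_fst (h : R -> R -> R) (x t : R) :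
  continuity_2d_pt h x t -> continuous (fun y => h y t) x.
Proof.
intros H; apply (continuous_comp_2 (fun y => y) (fun _ => t) h x).
- apply continuous_id.
- apply continuous_const.
- now apply continuity_2d_pt_filterlim.
Qed.

(** Leibniz's rule gives the integral of [h] over [a, b], and [h] is also the x-derivative of [g],
    so the fundamental theorem of calculus applies. *)
Lemma is_derive_RInt_conservation (f g h : R -> R -> R) (a b t : R) :
  conservation_law f g h ->
  is_derive (fun s => RInt (fun x => f x s) a b) t (g b t - g a t).
Proof.
intros (f_cont & f_t & g_x & h_cont).
assert (E : forall x s, Derive (fun z => f x z) s = h x s).
{ intros x s; apply is_derive_unique, f_t. }
evar_last.
- apply (is_derive_RInt_param (fun s x => f x s) a b t).
  + apply filter_forall; intros s x _; exists (h x s); apply f_t.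
  + intros x _.
    (* In Leibniz's rule the parameter comes first, so the joint continuity of [h] is composed with
       the exchange of the two coordinates. *)
    apply (continuity_2d_pt_ext (fun s y => h y s)); [intros s y; now rewrite E |].
    apply continuity_2d_pt_filterlim.
    apply (continuous_comp_2 (fun p : R * R => snd p) (fun p : R * R => fst p) h (t, x)).
    * apply continuous_snd.
    * apply continuous_fst.
    * apply continuity_2d_pt_filterlim, h_cont.
  + apply filter_forall; intros s.
    apply (ex_RInt_continuous (V := R_CompleteNormedModule)); auto.
- apply (is_RInt_unique (V := R_CompleteNormedModule)).
  apply (is_RInt_ext (fun x => h x t)); [intros x _; now rewrite E |].
  apply (is_RInt_derive (V := R_CompleteNormedModule) (fun x => g x t));
    intros x _; [apply g_x | now apply continuity_2d_pt_continuous_fst].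
Qed.

Lemma ex_RInt_gen_inv_sq_decay (f : R -> R -> R) (t : R) :
  (forall x, continuous (fun y => f y t) x) -> inv_sq_decay f ->
  ex_RInt_gen (fun x => f x t) (Rbar_locally m_infty) (Rbar_locally p_infty).
Proof.
intros f_cont f_decay; destruct (f_decay t t) as [M HM].
apply (ex_RInt_gen_inv_sq _ M); [exact f_cont |].
intros x; apply HM; lra.
Qed.

(* By the mean value theorem in time, the integrals over [a, b] at times s and t
   differ by at most |s - t| (M / a^2 + M / b^2), where M bounds x^2 |g| between the times. *)
Lemma RInt_gen_conservation (f g h : R -> R -> R) (s t : R) :
  conservation_law f g h -> inv_sq_decay f -> inv_sq_decay g ->
  RInt_gen (fun x => f x s) (Rbar_locally m_infty) (Rbar_locally p_infty) =
  RInt_gen (fun x => f x t) (Rbar_locally m_infty) (Rbar_locally p_infty).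
Proof.
intros fgh f_decay g_decay; assert (f_cont := proj1 fgh).
assert (Hs := RInt_gen_correct _
  (ex_RInt_gen_inv_sq_decay f s (fun x => f_cont x s) f_decay)).
assert (Ht := RInt_gen_correct _
  (ex_RInt_gen_inv_sq_decay f t (fun x => f_cont x t) f_decay)).
assert (Hd := is_RInt_gen_minus _ _ _ _ Hs Ht).
set (ls := RInt_gen _ _ _) in Hs, Hd |- *.
set (lt := RInt_gen _ _ _) in Ht, Hd |- *.
(* The difference of the densities at the two times has improper integral 0. By uniqueness of the
   value, this equals [ls - lt]. *)
assert (Z : is_RInt_gen (fun x => minus (f x s) (f x t))
  (Rbar_locally m_infty) (Rbar_locally p_infty) 0).
{ apply is_RInt_gen_filterlim.
  { intros x; apply (continuous_minus (V := R_NormedModule)); apply f_cont. }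
  destruct (g_decay (Rmin t s) (Rmax t s)) as [M HM].
  assert (M0 : 0 <= M).
  { assert (Rmin t s <= s <= Rmax t s) by (split; [apply Rmin_r | apply Rmax_r]).
    specialize (HM 0 s H); rewrite pow_i, Rmult_0_l in HM by auto; exact HM. }
  apply (filterlim_locally (F := filter_prod (Rbar_locally m_infty) (Rbar_locally p_infty))).
  intros eps; assert (E := cond_pos eps).
  set (D := Rabs (s - t)); assert (D0 : 0 <= D) by apply Rabs_pos.
  (* The summand 1 gives both N >= 1 and the strict inequality 2 M D < eps N. Since N >= 1, any |x|
     > N satisfies x^2 >= N, so |g| <= M / N there, and the two endpoints together contribute at
     most 2 M D / N < eps. *)
  set (N := 1 + 2 * M * D / eps).
  assert (N1 : 1 <= N).
  { unfold N; assert (0 <= 2 * M * D / eps); [| lra].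
    apply Rdiv_le_0_compat; [nra | lra]. }
  assert (HN : 2 * M * D < eps * N).
  { unfold N; replace (eps * (1 + 2 * M * D / eps)) with (eps + 2 * M * D) by (field; lra). lra. }
  assert (G : forall x r, N < Rabs x -> Rmin t s <= r <= Rmax t s -> N * Rabs (g x r) <= M).
  { intros x r Hx Hr; eapply Rle_trans; [| apply (HM x r Hr)].
    apply Rmult_le_compat_r; [apply Rabs_pos |].
    rewrite <- (pow2_abs x); nra. }
  apply (Filter_prod _ _ _ (fun a => a < - N) (fun b => N < b));
    [now exists (- N) | now exists N |].
  intros a b Ha Hb; simpl.
  assert (Hex : forall r, ex_RInt (fun x => f x r) a b).
  { intros r; apply (ex_RInt_continuous (V := R_CompleteNormedModule)); auto. }
  rewrite (RInt_minus (V := R_CompleteNormedModule)) by apply Hex.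
  change (Rabs (RInt (fun x => f x s) a b - RInt (fun x => f x t) a b - 0) < eps).
  (* The times [s] and [t] may come in either order, so the intermediate time [c] is only known to
     lie between their [Rmin] and [Rmax], the interval on which [M] was taken. *)
  destruct (MVT_gen (fun r => RInt (fun x => f x r) a b) t s
    (fun r => g b r - g a r)) as [c [Hc ->]].
  - intros r _; now apply is_derive_RInt_conservation with h.
  - intros r _; apply continuity_pt_filterlim.
    apply (ex_derive_continuous (V := R_NormedModule) (fun r => RInt (fun x => f x r) a b)).
    exists (g b r - g a r); now apply is_derive_RInt_conservation with h.
  - rewrite Rminus_0_r, Rabs_mult; fold D.
    assert (Ga := G a c ltac:(rewrite Rabs_left; lra) Hc).
    assert (Gb := G b c ltac:(rewrite Rabs_right; lra) Hc).
    assert (T : Rabs (g b c - g a c) <= Rabs (g b c) + Rabs (g a c)).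
    { unfold Rminus; rewrite <- (Rabs_Ropp (g a c)); apply Rabs_triang. }
    apply (Rmult_lt_reg_l N); [lra |].
    apply Rle_lt_trans with (2 * M * D); [| lra].
    rewrite <- Rmult_assoc; apply Rmult_le_compat_r; [exact D0 |].
    nra. }
assert (U1 := is_RInt_gen_unique _ _ Hd).
assert (U2 : 0 = ls - lt) by (rewrite <- (is_RInt_gen_unique _ _ Z); exact U1).
lra.
Qed.

Lemma is_derive_RInt_gen_conservation (f g h : R -> R -> R) (t : R) :
  conservation_law f g h -> inv_sq_decay f -> inv_sq_decay g ->
  is_derive (fun s => RInt_gen (fun x => f x s)
    (Rbar_locally m_infty) (Rbar_locally p_infty)) t 0.
Proof.
intros fgh f_decay g_decay; apply (is_derive_ext (fun _ => RInt_gen (fun x => f x t)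
  (Rbar_locally m_infty) (Rbar_locally p_infty))).
- intros s; now apply RInt_gen_conservation with g h.
- apply (is_derive_const (V := R_NormedModule)).
Qed.

(** * Derivatives, smoothness and decay of matrix-valued functions *)

Lemma is_derive_Mdx {m n : nat} (A : R -> R -> matrix (T := C) m n) (i j : nat) (x t : R) :
  (i < m)%nat -> (j < n)%nat -> smooth (fun y s => entry (A y s) i j) ->
  is_derive (K := R_AbsRing) (V := C_R_NormedModule)
    (fun y => entry (A y t) i j) x (entry (Mdx A x t) i j).
Proof.
intros Hi Hj H; unfold Mdx, entry at 2; rewrite coeff_mat_bij by assumption.
apply (ex_derive_CDerive (fun y => entry (A y t) i j)), (H nil x t).
Qed.

Lemma is_derive_Mdt {m n : nat} (A : R -> R -> matrix (T := C) m n) (i j : nat) (x t : R) :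
  (i < m)%nat -> (j < n)%nat -> smooth (fun y s => entry (A y s) i j) ->
  is_derive (K := R_AbsRing) (V := C_R_NormedModule)
    (fun s => entry (A x s) i j) t (entry (Mdt A x t) i j).
Proof.
intros Hi Hj H; unfold Mdt, entry at 2; rewrite coeff_mat_bij by assumption.
apply (ex_derive_CDerive (fun s => entry (A x s) i j)), (H nil x t).
Qed.

Lemma smooth_Mdx (A : R -> R -> matrix (T := C) 2 1) :
  (forall i, (i < 2)%nat -> smooth (fun x t => entry (A x t) i 0)) ->
  forall i, (i < 2)%nat -> smooth (fun x t => entry (Mdx A x t) i 0).
Proof.
(* For a concrete index, the entry of [Mdx A] reduces by computation to [dx] of the entry of [A],
   hence the case split on [i]. *)
intros H [| [| i]] Hi; [| | lia].
- exact (smooth_pd coord_x _ (H 0%nat Hi)).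
- exact (smooth_pd coord_x _ (H 1%nat Hi)).
Qed.

Lemma smooth_Mdt (A : R -> R -> matrix (T := C) 2 1) :
  (forall i, (i < 2)%nat -> smooth (fun x t => entry (A x t) i 0)) ->
  forall i, (i < 2)%nat -> smooth (fun x t => entry (Mdt A x t) i 0).
Proof.
intros H [| [| i]] Hi; [| | lia].
- exact (smooth_pd coord_t _ (H 0%nat Hi)).
- exact (smooth_pd coord_t _ (H 1%nat Hi)).
Qed.

Lemma Mdx_Mdt (A : R -> R -> matrix (T := C) 2 1) (x t : R) :
  (forall i, (i < 2)%nat -> smooth (fun y s => entry (A y s) i 0)) ->
  Mdx (Mdt A) x t = Mdt (Mdx A) x t.
Proof.
intros H; apply mk_matrix_ext; intros [| [| i]] [| j] Hi Hj; try lia.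
- exact (smooth_dx_dt _ x t (H 0%nat Hi)).
- exact (smooth_dx_dt _ x t (H 1%nat Hi)).
Qed.

(** Each product in u^dagger v has one factor from [U] and one from [V]. Decay of order 1 of each
    factor gives order 2 for the product, and |Im z| <= |z|. *)
Lemma inv_sq_decay_Im_adj_mul (U V : R -> R -> matrix (T := C) 2 1) :
  (forall i, (i < 2)%nat -> rapidly_decaying (fun x t => entry (U x t) i 0)) ->
  (forall i, (i < 2)%nat -> rapidly_decaying (fun x t => entry (V x t) i 0)) ->
  inv_sq_decay (fun x t => Im (adj_mul (U x t) (V x t))).
Proof.
intros HU HV a b.
destruct (HU 0%nat ltac:(auto) nil 1%nat a b) as [M0 H0].
destruct (HU 1%nat ltac:(auto) nil 1%nat a b) as [M1 H1].
destruct (HV 0%nat ltac:(auto) nil 1%nat a b) as [M2 H2].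
destruct (HV 1%nat ltac:(auto) nil 1%nat a b) as [M3 H3].
exists (M0 * M2 + M1 * M3); intros x t Ht.
specialize (H0 x t Ht); specialize (H1 x t Ht).
specialize (H2 x t Ht); specialize (H3 x t Ht).
simpl pds in H0, H1, H2, H3; rewrite pow_1 in H0, H1, H2, H3.
apply Rle_trans with (Rabs x ^ 2 *
  (Cmod (entry (U x t) 0 0) * Cmod (entry (V x t) 0 0)
   + Cmod (entry (U x t) 1 0) * Cmod (entry (V x t) 1 0))).
- rewrite pow2_abs; apply Rmult_le_compat_l; [apply pow2_ge_0 |].
  eapply Rle_trans; [exact (Rle_trans _ _ _ (Rmax_r _ _) (Rmax_Cmod _)) |].
  rewrite adj_mul_entries; eapply Rle_trans; [apply Cmod_triangle |].
  rewrite !Cmod_mult, !Cmod_conj; apply Rle_refl.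
- assert (P := Rabs_pos x).
  assert (forall z, 0 <= Rabs x * Cmod z)
    by (intros z; apply Rmult_le_pos; [exact P | apply Cmod_ge_0]).
  replace (Rabs x ^ 2 *
    (Cmod (entry (U x t) 0 0) * Cmod (entry (V x t) 0 0)
     + Cmod (entry (U x t) 1 0) * Cmod (entry (V x t) 1 0)))
   with ((Rabs x * Cmod (entry (U x t) 0 0)) * (Rabs x * Cmod (entry (V x t) 0 0))
     + (Rabs x * Cmod (entry (U x t) 1 0)) * (Rabs x * Cmod (entry (V x t) 1 0))) by ring.
  apply Rplus_le_compat; apply Rmult_le_compat; auto.
Qed.

Theorem mainTheorem4
  (gamma : R)
  (E : R -> R -> matrix (T := C) 2 1)
  (Q : R -> R -> matrix (T := C) 2 2)
  (E_smooth : forall i : nat, (i < 2)%nat ->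
     smooth (fun x t => entry (E x t) i 0))
  (Q_def : is_dx_inv Q (Mdt (rho E)))
  (Q_herm : forall x t : R, Hermitian (Q x t))
  (E_eq : forall x t : R,
     Mdt (Mdx E) x t = Mmult (T := C_Ring) (KG_matrix gamma (Q x t)) (E x t)) :
  (forall x t : R,
     (dx (fun y s => adj_mul (E y s) (Mdt E y s)) x t
      - dt (fun y s => adj_mul (Mdx E y s) (E y s)) x t)%C = RtoC 0) /\
  (forall x t : R,
     Derive (fun y => Im (adj_mul (E y t) (Mdt E y t))) x
     - Derive (fun s => Im (adj_mul (Mdx E x s) (E x s))) t = 0) /\
  (forall L : R, 0 < L ->
     (forall x t : R, E (x + L) t = E x t) ->
     forall a t : R,
       is_derive
         (fun s => RInt (fun x => Im (adj_mul (Mdx E x s) (E x s))) a (a + L))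
         t 0) /\
  ((forall i : nat, (i < 2)%nat ->
      rapidly_decaying (fun x t => entry (E x t) i 0)) ->
   (forall t : R,
      ex_RInt_gen (fun x => Im (adj_mul (Mdx E x t) (E x t)))
        (Rbar_locally m_infty) (Rbar_locally p_infty)) /\
   (forall t : R,
      is_derive
        (fun s => RInt_gen (fun x => Im (adj_mul (Mdx E x s) (E x s)))
           (Rbar_locally m_infty) (Rbar_locally p_infty))
        t 0)).

Proof.
assert (E_xt : forall x t, adj_mul (Mdt (Mdx E) x t) (E x t)
                           = adj_mul (E x t) (Mdt (Mdx E) x t)).
{ intros x t; rewrite E_eq; apply Hermitian_adj_mul, Hermitian_KG_matrix, Q_herm. }
assert (Ex_smooth := smooth_Mdx E E_smooth).
assert (Et_smooth := smooth_Mdt E E_smooth).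
assert (Ext_smooth := smooth_Mdt _ Ex_smooth).
set (flux := fun x t => (adj_mul (Mdx E x t) (Mdt E x t)
                         + adj_mul (E x t) (Mdt (Mdx E) x t))%C).
assert (G : forall x t, is_derive (K := R_AbsRing) (V := C_R_NormedModule)
  (fun y => adj_mul (E y t) (Mdt E y t)) x (flux x t)).
{ intros x t; unfold flux; rewrite <- (Mdx_Mdt E) by assumption.
  apply (is_derive_adj_mul (fun y => E y t) (fun y => Mdt E y t));
    intros i Hi; apply is_derive_Mdx; auto. }
assert (F : forall x t, is_derive (K := R_AbsRing) (V := C_R_NormedModule)
  (fun s => adj_mul (Mdx E x s) (E x s)) t (flux x t)).
(* The product rule yields E_xt^dagger E + E_x^dagger E_t. The equation for [E] enters only through
   this rewriting, which exchanges E^dagger E_xt for E_xt^dagger E. *)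
{ intros x t; unfold flux; rewrite <- E_xt, Cplus_comm.
  apply (is_derive_adj_mul (fun s => Mdx E x s) (fun s => E x s));
    intros i Hi; apply is_derive_Mdt; auto. }
assert (L : conservation_law (fun x t => Im (adj_mul (Mdx E x t) (E x t)))
  (fun x t => Im (adj_mul (E x t) (Mdt E x t))) (fun x t => Im (flux x t))).
{ split; [| split; [| split]]; intros x t.
  - apply (continuity_2d_pt_continuous_fst (fun y s => Im (adj_mul (Mdx E y s) (E y s)))).
    now apply continuity_2d_pt_Im_adj_mul.
  - apply (is_derive_Re_Im (fun s => adj_mul (Mdx E x s) (E x s))), F.
  - apply (is_derive_Re_Im (fun y => adj_mul (E y t) (Mdt E y t))), G.
  - apply (continuity_2d_pt_plus (fun y s => Im (adj_mul (Mdx E y s) (Mdt E y s)))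
      (fun y s => Im (adj_mul (E y s) (Mdt (Mdx E) y s))));
      now apply continuity_2d_pt_Im_adj_mul. }
split; [| split; [| split]].
- intros x t.
  assert (Gx : dx (fun y s => adj_mul (E y s) (Mdt E y s)) x t = flux x t)
    by exact (is_derive_CDerive _ _ _ (G x t)).
  assert (Ft : dt (fun y s => adj_mul (Mdx E y s) (E y s)) x t = flux x t)
    by exact (is_derive_CDerive _ _ _ (F x t)).
  rewrite Gx, Ft; ring.
- intros x t; destruct L as (_ & Lt & Lx & _).
  apply Rminus_diag_eq.
  exact (eq_trans (is_derive_unique _ _ _ (Lx x t)) (eq_sym (is_derive_unique _ _ _ (Lt x t)))).
- intros P HP E_per a t.
  (* Periodicity holds at every time, so it passes to the time derivative, and E^dagger E_t takes
     the same value at both ends of the period. *)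
  assert (Et_per : Mdt E (a + P) t = Mdt E a t).
  { apply mk_matrix_ext; intros i j Hi Hj; unfold dt, CDerive; f_equal;
      apply Derive_ext; intros s; now rewrite E_per. }
  evar_last; [apply (is_derive_RInt_conservation _ _ _ a (a + P) t L) |].
  cbv beta; rewrite E_per, Et_per; ring.
- intros E_decay.
  assert (Ex_decay : forall i, (i < 2)%nat ->
    rapidly_decaying (fun x t => entry (Mdx E x t) i 0)).
  { intros [| [| i]] Hi; [| | lia].
    - exact (rapidly_decaying_pd coord_x _ (E_decay 0%nat Hi)).
    - exact (rapidly_decaying_pd coord_x _ (E_decay 1%nat Hi)). }
  assert (Et_decay : forall i, (i < 2)%nat ->
    rapidly_decaying (fun x t => entry (Mdt E x t) i 0)).
  { intros [| [| i]] Hi; [| | lia].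
    - exact (rapidly_decaying_pd coord_t _ (E_decay 0%nat Hi)).
    - exact (rapidly_decaying_pd coord_t _ (E_decay 1%nat Hi)). }
  split; intros t.
  + apply (ex_RInt_gen_inv_sq_decay (fun x s => Im (adj_mul (Mdx E x s) (E x s)))).
    * intros x; apply L.
    * now apply inv_sq_decay_Im_adj_mul.
  + apply (is_derive_RInt_gen_conservation _ _ _ t L); now apply inv_sq_decay_Im_adj_mul.
Qed.
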